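(* For every integer $d\ge4$ there exists a $d$-dimensional integral polytope $\mathcal{P}$ such that the coefficients of $t$ and $t^2$ in $i(\mathcal{P},t)$ are negative and the coefficients of $t^3,t^4,\dots,t^{d-2}$ in $i(\mathcal{P},t)$ are positive.
   Context: An integral polytope is a convex polytope all of whose vertices have integer coordinates. For an integral polytope $\mathcal{P}\subseteq\mathbb{R}^N$ of dimension $d$, $i(\mathcal{P},t)=|t\mathcal{P}\cap\mathbb{Z}^N|$ ($t$ a positive integer) is a polynomial in $t$ of degree $d$, the Ehrhart polynomial. *)

(* Defs.v *)
From HB Require Import structures.
From mathcomp Require Import all_boot all_order all_algebra.
From mathcomp Require Import boolp classical_sets functions cardinality reals.

Set Implicit Arguments.
Unset Strict Implicit.
Unset Printing Implicit Defensive.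

Import Order.TTheory GRing.Theory Num.Theory.

Local Open Scope classical_set_scope.
Local Open Scope card_scope.
Local Open Scope ring_scope.

Definition convex_hull (R : realType) (N : nat) (A : set 'rV[R]_N) :
    set 'rV[R]_N :=
  [set x | exists (n : nat) (v : 'I_n -> 'rV[R]_N) (w : 'I_n -> R),
    [/\ forall i, A (v i), forall i, 0 <= w i, \sum_(i < n) w i = 1
      & x = \sum_(i < n) w i *: v i]].

Definition affine_hull (R : realType) (N : nat) (A : set 'rV[R]_N) :
    set 'rV[R]_N :=
  [set x | exists (n : nat) (v : 'I_n -> 'rV[R]_N) (w : 'I_n -> R),
    [/\ forall i, A (v i), \sum_(i < n) w i = 1
      & x = \sum_(i < n) w i *: v i]].

(* The affine hull of A is a translate of a d-dimensional linear subspace;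
   in particular A is nonempty. *)
Definition has_dim (R : realType) (N : nat) (A : set 'rV[R]_N) (d : nat) :
    Prop :=
  exists (x0 : 'rV[R]_N) (U : {vspace 'rV[R]_N}),
    \dim U = d /\ affine_hull A = [set x | x - x0 \in U].

Definition convex_polytope (R : realType) (N : nat) (P : set 'rV[R]_N) : Prop :=
  exists A : set 'rV[R]_N, finite_set A /\ P = convex_hull A.

(* The vertices of a polytope are its extreme points. *)
Definition vertices (R : realType) (N : nat) (P : set 'rV[R]_N) :
    set 'rV[R]_N :=
  [set x | P x /\ forall (y z : 'rV[R]_N) (t : R), P y -> P z -> 0 < t < 1 ->
    x = t *: y + (1 - t) *: z -> y = x /\ z = x].

Definition integer_points (R : realType) (N : nat) : set 'rV[R]_N :=
  [set x | forall j, x 0 j \is a Num.int].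

Definition integral_polytope (R : realType) (N : nat) (P : set 'rV[R]_N) :
    Prop :=
  convex_polytope P /\ vertices P `<=` @integer_points R N.

Definition dilate (R : realType) (N : nat) (t : nat) (P : set 'rV[R]_N) :
    set 'rV[R]_N :=
  [set t%:R *: x | x in P].

(* [A #= `I_n] says that A is finite with exactly n elements.  A polynomial is
   determined by its values at the positive integers, so for each P at most one
   p satisfies this. *)
Definition is_ehrhart_polynomial (R : realType) (N : nat) (P : set 'rV[R]_N)
    (p : {poly R}) : Prop :=
  forall t : nat, (0 < t)%N ->
    exists n : nat,
      (dilate t P `&` @integer_points R N #= `I_n) /\ p.[t%:R] = n%:R.

(* Main.v *)
(** Let T be the Reeve tetrahedron with vertices 0, e1, e2, e1 + e2 + 24 e3; its
    Ehrhart polynomial is (1 + t)^2 + 4 (t^3 - t), so that of T x [0,1] is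
    1 - t - t^2 + 5 t^3 + 4 t^4, which already has the required signs.
    Dilating T x [0,1] by n multiplies the i-th coefficient by n^i; hence for n
    large, taking the product with the cube [0,1]^(d-4) multiplies the polynomial
    by (1 + t)^(d-4) without changing the signs of the coefficients of
    t, t^2, t^3, and all higher coefficients are dominated by positive terms. *)
From HB Require Import structures.
Require Import Defs.
From mathcomp Require Import all_boot all_order all_algebra.
From mathcomp Require Import boolp classical_sets functions cardinality reals.
From mathcomp Require Import finmap zify ring lra.
Import Order.TTheory GRing.Theory Num.Theory.
Local Open Scope classical_set_scope.
Local Open Scope ring_scope.

(** Counting lattice points thereby reduces to exhibiting a duplicate-free list of them. *)
Lemma card_eq_seqP (T : choiceType) (A : set T) (n : nat) :
  (A #= `I_n)%card <-> exists s : seq T, [/\ uniq s, size s = n & A = [set` s]].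
Proof.
split=> [An | [s [us <- ->]]].
  have finA : finite_set A by apply/finite_setP; exists n.
  exists (enum_fset (fset_set A)); split; first exact: fset_uniq.
    exact: card_fset_set.
  by rewrite -[LHS](fset_setK finA).
have -> : [set` s] = [set` [fset x in s]%fset].
  by apply/seteqP; split=> x /=; rewrite inE.
apply/card_eq_fsetP.
have /perm_size -> : perm_eq [fset x in s]%fset s.
  by apply: uniq_perm => [|//|x]; [exact: fset_uniq | rewrite inE].
by [].
Qed.

Section ReevePrism.
Set Implicit Arguments.
Unset Strict Implicit.
Unset Printing Implicit Defensive.
Variable R : realType.
Implicit Types N M : nat.

(** * Convex hulls, affine hulls and extreme points *)

Lemma sub_convex_hull N (A : set 'rV[R]_N) : A `<=` convex_hull A.
Proof.
move=> x Ax; exists 1%N, (fun=> x), (fun=> 1); split=> //.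
  by rewrite big_ord1.
by rewrite big_ord1 scale1r.
Qed.

Lemma affine_hull_subset N (A B : set 'rV[R]_N) :
  A `<=` B -> affine_hull A `<=` affine_hull B.
Proof.
by move=> AB x [n [v [w [Av w1 ->]]]]; exists n, v, w; split=> // i; exact: AB.
Qed.

Lemma convex_hull_fin N (A : set 'rV[R]_N) (I : finType) (v : I -> 'rV[R]_N)
    (w : I -> R) :
  (forall i, A (v i)) -> (forall i, 0 <= w i) -> \sum_i w i = 1 ->
  convex_hull A (\sum_i w i *: v i).
Proof.
move=> Av w0 w1; exists #|I|, (v \o enum_val), (w \o enum_val); split=> //=.
  by rewrite -w1 (big_enum_val w).
by rewrite (big_enum_val (fun i => w i *: v i)).
Qed.

Lemma affine_hull_fin N (A : set 'rV[R]_N) (I : finType) (v : I -> 'rV[R]_N)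
    (w : I -> R) :
  (forall i, A (v i)) -> \sum_i w i = 1 -> affine_hull A (\sum_i w i *: v i).
Proof.
move=> Av w1; exists #|I|, (v \o enum_val), (w \o enum_val); split=> //=.
  by rewrite -w1 (big_enum_val w).
by rewrite (big_enum_val (fun i => w i *: v i)).
Qed.

(** A convex combination averages the values of [f] on [A]. This is how inequalities checked at the
    generators pass to the whole polytope. *)
Lemma convex_hull_ge N (A : set 'rV[R]_N) (f : 'rV[R]_N -> R) (c : R) :
  scalar f -> (forall x, A x -> c <= f x) ->
  forall x, convex_hull A x -> c <= f x.
Proof.
move=> linf fA x [n [v [w [Av w0 w1 ->]]]].
pose g : {scalar 'rV[R]_N} :=
  HB.pack f (GRing.isLinear.Build _ _ _ _ f linf).
rewrite -[f _]/(g _) linear_sum -[c]mul1r -w1 mulr_suml.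
by apply: ler_sum => i _; rewrite linearZ /= ler_wpM2l//; exact: fA.
Qed.

(** Splitting a generator of positive weight off a convex combination writes an extreme point as a
    mixture of that generator and another point of the hull, so it equals the generator. Hence
    integer generators yield integer vertices. *)
Lemma vertices_convex_hull N (A : set 'rV[R]_N) : vertices (convex_hull A) `<=` A.
Proof.
move=> x [[n [v [w [Av w0 w1 xE]]]] xP].
have [i wi] : exists i, 0 < w i.
  apply: contrapT => /forallNP w_le0; have := oner_eq0 R; rewrite -w1 big1 ?eqxx//.
  by move=> i _; apply/eqP; rewrite eq_le w0 andbT leNgt; exact/negP.
have sumw : \sum_(j | j != i) w j = 1 - w i.
  by rewrite -w1 [in RHS](bigD1 i)//= addrAC subrr add0r.
have sumw_ge0 : 0 <= \sum_(j | j != i) w j by apply: sumr_ge0.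
(* Extremality speaks of coefficients strictly between 0 and 1, so weight 1 is treated apart: all
   other weights then vanish. *)
have [wi1|wiN1] := eqVneq (w i) 1.
  have w0' j : j != i -> w j = 0.
    move=> ji; apply/eqP; move: sumw; rewrite wi1 subrr => /eqP.
    by rewrite psumr_eq0// => /allP/(_ j); rewrite mem_index_enum ji => /(_ isT).
  rewrite xE (bigD1 i)//= wi1 scale1r big1 ?addr0//.
  by move=> j /w0' ->; rewrite scale0r.
have wi_lt1 : w i < 1 by rewrite lt_neqAle wiN1 -subr_ge0 -sumw.
have wi_neq : 1 - w i != 0 by rewrite subr_eq0 eq_sym.
(* The remaining weights, rescaled to sum to 1. *)
pose u j := if j == i then 0 else w j / (1 - w i).
have uE (j : 'I_n) : j != i -> u j = w j / (1 - w i) by rewrite /u => /negbTE ->.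
have ui : u i = 0 by rewrite /u eqxx.
have Cz : convex_hull A (\sum_j u j *: v j).
  apply: convex_hull_fin => //.
    move=> j; rewrite /u; case: eqP => // _.
    by rewrite divr_ge0// subr_ge0 ltW.
  rewrite (bigD1 i)//= ui add0r (eq_bigr _ uE) -mulr_suml sumw divff//.
have [||<- //] := xP (v i) _ (w i) (sub_convex_hull (Av i)) Cz.
- by rewrite wi.
rewrite xE (bigD1 i)//=; congr (_ + _).
rewrite [in RHS](bigD1 i)//= ui scale0r add0r scaler_sumr.
by apply: eq_bigr => j /uE ->; rewrite scalerA mulrCA divff// mulr1.
Qed.

(** * Cartesian products and dilations *)

Definition set_row_mx N M (A : set 'rV[R]_N) (B : set 'rV[R]_M) :
    set 'rV[R]_(N + M) :=
  [set x | A (lsubmx x) /\ B (rsubmx x)].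

Lemma set_row_mxE N M (A : set 'rV[R]_N) (B : set 'rV[R]_M) :
  set_row_mx A B = [set row_mx a b | a in A & b in B].
Proof.
apply/seteqP; split=> [x [Ax Bx]|_ [a Aa [b Bb <-]]].
  by exists (lsubmx x) => //; exists (rsubmx x) => //; rewrite hsubmxK.
by split; rewrite ?row_mxKl ?row_mxKr.
Qed.

(** The products [w i * u j] are joint weights with marginals [w] and [u]. Signs are left free so
    that affine hulls are covered along with convex ones. *)
Lemma sum_row_mx N M n m (a : 'I_n -> 'rV[R]_N) (b : 'I_m -> 'rV[R]_M)
    (w : 'I_n -> R) (u : 'I_m -> R) :
  \sum_i w i = 1 -> \sum_i u i = 1 ->
  \sum_(ij : 'I_n * 'I_m) (w ij.1 * u ij.2) = 1 /\
  \sum_(ij : 'I_n * 'I_m) (w ij.1 * u ij.2) *: row_mx (a ij.1) (b ij.2) =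
    row_mx (\sum_i w i *: a i) (\sum_i u i *: b i).
Proof.
move=> w1 u1; split.
  rewrite -(pair_bigA _ (fun i j => w i * u j))/= -[RHS]w1.
  by apply: eq_bigr => i _; rewrite -mulr_sumr u1 mulr1.
rewrite -(pair_bigA _ (fun i j => (w i * u j) *: row_mx (a i) (b j)))/=.
rewrite -[LHS]hsubmxK; congr row_mx; rewrite linear_sum.
  apply: eq_bigr => i _; rewrite linear_sum -[in RHS](mulr1 (w i)) -u1 mulr_sumr scaler_suml.
  by apply: eq_bigr => j _; rewrite linearZ /= row_mxKl.
rewrite (eq_bigr (fun i => \sum_j w i *: (u j *: b j))) /=; last first.
  move=> i _; rewrite linear_sum; apply: eq_bigr => j _.
  by rewrite linearZ /= row_mxKr scalerA.
rewrite exchange_big; apply: eq_bigr => j _ /=.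
by rewrite -scaler_suml w1 scale1r.
Qed.

Lemma convex_hull_row_mx N M (A : set 'rV[R]_N) (B : set 'rV[R]_M) :
  convex_hull (set_row_mx A B) = set_row_mx (convex_hull A) (convex_hull B).
Proof.
apply/seteqP; split=> [x [n [v [w [Av w0 w1 ->]]]]|x].
  split; [exists n, (lsubmx \o v), w|exists n, (rsubmx \o v), w];
    split=> //= [i|]; rewrite ?linear_sum; do ?[by case: (Av i)];
    by apply: eq_bigr => i _; rewrite linearZ.
move=> [[n [a [w [Aa w0 w1 lE]]]] [m [b [u [Bb u0 u1 rE]]]]].
rewrite -[x]hsubmxK lE rE.
have [wu1 <-] := sum_row_mx a b w1 u1.
apply: convex_hull_fin => // ij; last exact: mulr_ge0.
by split; rewrite ?row_mxKl ?row_mxKr.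
Qed.

Lemma affine_hull_row_mxT N M (A : set 'rV[R]_N) (B : set 'rV[R]_M) :
  affine_hull A = setT -> affine_hull B = setT ->
  affine_hull (set_row_mx A B) = setT.
Proof.
move=> AT BT; apply/seteqP; split=> // x _.
have [n [a [w [Aa w1 lE]]]] : affine_hull A (lsubmx x) by rewrite AT.
have [m [b [u [Bb u1 rE]]]] : affine_hull B (rsubmx x) by rewrite BT.
rewrite -[x]hsubmxK lE rE.
have [wu1 <-] := sum_row_mx a b w1 u1.
apply: affine_hull_fin => // ij.
by split; rewrite ?row_mxKl ?row_mxKr.
Qed.

Lemma integer_points_row_mx N M :
  @integer_points R (N + M) =
  set_row_mx (@integer_points R N) (@integer_points R M).
Proof.
apply/seteqP; split=> [x xZ|x [lZ rZ] j].
  by split=> j; rewrite mxE; exact: xZ.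
rewrite -[x]hsubmxK; case: (splitP j) => k jk.
  by rewrite (_ : j = lshift M k) ?row_mxEl; [exact: lZ|exact: val_inj].
by rewrite (_ : j = rshift N k) ?row_mxEr; [exact: rZ|exact: val_inj].
Qed.

Lemma dilate_row_mx N M t (A : set 'rV[R]_N) (B : set 'rV[R]_M) :
  dilate t (set_row_mx A B) = set_row_mx (dilate t A) (dilate t B).
Proof.
apply/seteqP; split=> [_ [x [Ax Bx] <-]|x [[a Aa lE] [b Bb rE]]].
  by split; rewrite linearZ; [exists (lsubmx x)|exists (rsubmx x)].
exists (row_mx a b); first by split; rewrite ?row_mxKl ?row_mxKr.
by rewrite scale_row_mx lE rE hsubmxK.
Qed.

Lemma card_set_row_mx N M (A : set 'rV[R]_N) (B : set 'rV[R]_M) n m :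
  (A #= `I_n)%card -> (B #= `I_m)%card -> (set_row_mx A B #= `I_(n * m))%card.
Proof.
move=> /card_eq_seqP[s [us <- ->]] /card_eq_seqP[r [ur <- ->]].
apply/card_eq_seqP; exists [seq row_mx a b | a <- s, b <- r]; split.
- apply: allpairs_uniq => // -[a b] [a' b'] _ _ /=.
  by move=> /eq_row_mx[-> ->].
- by rewrite size_allpairs.
rewrite set_row_mxE; apply/seteqP; split=> x /=.
  by move=> [a sa [b rb <-]]; apply/allpairsP; exists (a, b).
by move=> /allpairsP[[a b] [sa rb ->]]; exists a => //; exists b.
Qed.

Lemma dilate_convex_hull N t (A : set 'rV[R]_N) :
  convex_hull (dilate t A) = dilate t (convex_hull A).
Proof.
apply/seteqP; split=> [x [n [v [w [Av w0 w1 ->]]]]|_ [x [n [v [w [Av w0 w1 ->]]]] <-]].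
  (* Preimages are chosen instead of dividing by [t], which may be 0. *)
  have /choice[a aP] i : exists a, A a /\ t%:R *: a = v i.
    by have [a Aa <-] := Av i; exists a.
  exists (\sum_i w i *: a i).
    by apply: convex_hull_fin => // i; case: (aP i).
  rewrite scaler_sumr; apply: eq_bigr => i _.
  by have [_ <-] := aP i; rewrite !scalerA mulrC.
exists n, (fun i => t%:R *: v i), w; split=> // [i|]; first by exists (v i).
by rewrite scaler_sumr; apply: eq_bigr => i _; rewrite !scalerA mulrC.
Qed.

(** * Ehrhart polynomials of full-dimensional lattice polytopes *)

(** The witness is a generating set rather than the polytope, since products and dilations act on
    generators. Requiring it to span the whole space affinely makes dimensions add under
    products. *)
Definition full_dim_ehrhart N (p : {poly R}) := exists A : set 'rV[R]_N,
  [/\ finite_set A, A `<=` @integer_points R N, affine_hull A = setT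
    & is_ehrhart_polynomial (convex_hull A) p].

Lemma full_dim_ehrhart_polytope N p : full_dim_ehrhart N p ->
  exists P : set 'rV[R]_N,
    [/\ integral_polytope P, has_dim P N & is_ehrhart_polynomial P p].
Proof.
move=> [A [finA AZ AT Ap]]; exists (convex_hull A); split=> //.
  split; first by exists A.
  by apply: subset_trans AZ; exact: vertices_convex_hull.
exists 0, fullv; split; first by rewrite dimvf dim_matrix mul1r.
apply/seteqP; split=> [x _ /=|x _]; first exact: memvf.
by apply: (affine_hull_subset (@sub_convex_hull N A)); rewrite AT.
Qed.

(** Lattice points of a dilated product are pairs of lattice points of the dilated factors, so the
    counts multiply. *)
Lemma full_dim_ehrhartM N M p q : full_dim_ehrhart N p ->
  full_dim_ehrhart M q -> full_dim_ehrhart (N + M) (p * q).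
Proof.
move=> [A [finA AZ AT Ap]] [B [finB BZ BT Bq]]; exists (set_row_mx A B); split.
- by rewrite set_row_mxE; exact: finite_image2.
- by rewrite integer_points_row_mx => x [/AZ ? /BZ ?].
- exact: affine_hull_row_mxT.
move=> t t0; have [n [An pn]] := Ap t t0; have [m [Bm qm]] := Bq t t0.
exists (n * m)%N; split; last by rewrite hornerM pn qm natrM.
have -> : dilate t (convex_hull (set_row_mx A B)) `&` @integer_points R (N + M) =
    set_row_mx (dilate t (convex_hull A) `&` @integer_points R N)
               (dilate t (convex_hull B) `&` @integer_points R M).
  rewrite convex_hull_row_mx dilate_row_mx integer_points_row_mx.
  by apply/seteqP; split=> x [[? ?] [? ?]].
exact: card_set_row_mx.
Qed.

(** Dilating by [n] and then by [t] is dilating by [t * n]. *)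
Lemma full_dim_ehrhart_dilate N p n : (0 < n)%N -> full_dim_ehrhart N p ->
  full_dim_ehrhart N (p \Po (n%:R *: 'X)).
Proof.
move=> n0 [A [finA AZ AT Ap]]; exists (dilate n A); split.
- exact: finite_image.
- by move=> _ [x /AZ xZ <-] j; rewrite mxE rpredM ?natr_int.
- apply/seteqP; split=> // x _.
  have [k [v [w [Av w1 xE]]]] : affine_hull A (n%:R^-1 *: x) by rewrite AT.
  exists k, (fun i => n%:R *: v i), w; split=> // [i|]; first by exists (v i).
  have n_neq0 : n%:R != 0 :> R by rewrite pnatr_eq0 -lt0n.
  rewrite -[LHS](scalerKV n_neq0) xE scaler_sumr.
  by apply: eq_bigr => i _; rewrite !scalerA mulrC.
move=> t t0; have tn0 : (0 < t * n)%N by rewrite muln_gt0 t0 n0.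
have [m [Am pm]] := Ap _ tn0; exists m; split; last first.
  by rewrite horner_comp hornerZ hornerX -natrM mulnC.
suff -> : dilate t (convex_hull (dilate n A)) = dilate (t * n) (convex_hull A) by [].
rewrite dilate_convex_hull; apply/seteqP; split=> [_ [_ [x Ax <-] <-]|_ [x Ax <-]].
  by exists x; rewrite // scalerA natrM.
by exists (n%:R *: x); [exists x|rewrite scalerA natrM].
Qed.

Lemma full_dim_ehrhart_eq N p q : (forall t : nat, p.[t%:R] = q.[t%:R]) ->
  full_dim_ehrhart N p -> full_dim_ehrhart N q.
Proof.
move=> pq [A [finA AZ AT Ap]]; exists A; split=> // t /Ap[n [An pn]].
by exists n; rewrite -pq.
Qed.

(** * The unit segment *)

Lemma full_dim_ehrhart_segment : full_dim_ehrhart 1 (1 + 'X).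
Proof.
pose c (x : R) : 'rV[R]_1 := const_mx x.
have cE (v : 'rV[R]_1) : v = c (v 0 0) by apply/rowP => j; rewrite !mxE ord1.
(* Barycentric coordinates with respect to 0 and 1, serving both the affine span and membership in
   the hull. *)
have sumc (v : 'rV[R]_1) : \sum_(i < 2) [:: 1 - v 0 0; v 0 0]`_i *: [:: c 0; c 1]`_i = v.
  by apply/rowP => j; rewrite !big_ord_recl big_ord0 /= !mxE ord1; ring.
have cA (i : 'I_2) : [set c 0; c 1] [:: c 0; c 1]`_i.
  by case: i => -[|[|//]] ? /=; [left|right].
exists [set c 0; c 1]; split.
- exact: finite_set2.
- by move=> _ [->|->] j; rewrite mxE ?rpred0 ?rpred1.
- apply/seteqP; split=> // v _; rewrite -[v]sumc.
  apply: affine_hull_fin => //.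
  by rewrite !big_ord_recl big_ord0 /=; ring.
move=> t t0; exists t.+1; split; last first.
  by rewrite hornerD hornerC hornerX -natr1 addrC.
apply/card_eq_seqP; exists [seq c k%:R | k <- iota 0 t.+1]; split.
- rewrite map_inj_uniq ?iota_uniq// => i j /(congr1 (fun u : 'rV_1 => u 0 0)).
  by rewrite !mxE => /eqP; rewrite eqr_nat => /eqP.
- by rewrite size_map size_iota.
have t0' : 0 < t%:R :> R by rewrite ltr0n.
apply/seteqP; split=> [v [[u uP <-] /(_ 0)]|v /mapP[k + ->]].
  have lin1 : scalar (fun x : 'rV[R]_1 => x 0 0) by move=> a x y; rewrite !mxE.
  have lin2 : scalar (fun x : 'rV[R]_1 => - x 0 0).
    by move=> a x y; rewrite !mxE; ring.
  have u0 : 0 <= u 0 0.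
    by apply: (convex_hull_ge lin1 _ uP) => _ [->|->]; rewrite mxE.
  have u1 : -1 <= - u 0 0.
    by apply: (convex_hull_ge lin2 _ uP) => _ [->|->]; rewrite mxE ?oppr0// oppr_le0.
  rewrite intrEge0; last by rewrite mxE mulr_ge0// ltW.
  move=> /natrP[k kE]; apply/mapP; exists k; last by rewrite [LHS]cE kE.
  rewrite mem_iota /= add0n ltnS -(ler_nat R) -kE mxE.
  by rewrite -[leRHS]mulr1 ler_wpM2l ?(ltW t0')// -lerN2.
rewrite mem_iota /= add0n ltnS => kt; split; last by move=> j; rewrite mxE natr_int.
exists (c (k%:R / t%:R)); last by apply/rowP => j; rewrite !mxE mulrC divfK// gt_eqF.
rewrite -[c (_ / _)]sumc mxE; apply: convex_hull_fin => //.
  case=> -[|[|//]] ? /=; last by rewrite divr_ge0.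
  by rewrite subr_ge0 ler_pdivrMr// mul1r ler_nat.
by rewrite !big_ord_recl big_ord0 /=; ring.
Qed.

(** * Sums used in the lattice point count *)

(** Induction on [w]: each [y] beyond [x] contributes [x], and the base case is a triangular
    number. *)
Lemma sum_minn (x w : nat) :
  (2 * \sum_(y < (x + w).+1) minn x y = x * (x + 1) + 2 * x * w)%N.
Proof.
elim: w => [|w IH].
  rewrite addn0 (eq_bigr (fun y : 'I_x.+1 => nat_of_ord y)); last first.
    by move=> y _; have := ltn_ord y; lia.
  rewrite -(big_mkord xpredT id) -/(index_iota 0 x.+1).
  elim: x => [|x IH]; first by rewrite big_nat1.
  by rewrite big_nat_recr//= mulnDr IH; lia.
by rewrite addnS big_ord_recr /= mulnDr IH; lia.
Qed.

(* Reversing y turns the truncated x + y - t = max(0, x + y - t) into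
   x - minn x y. *)
Lemma sum_reeve_column (x t : nat) : (x <= t)%N ->
  (\sum_(y < t.+1) (minn x y - (x + y - t)) = x * (t - x))%N.
Proof.
move=> xt.
have H : (\sum_(y < t.+1) (minn x y - (x + y - t)) + \sum_(y < t.+1) x =
  \sum_(y < t.+1) minn x y + \sum_(y < t.+1) minn x y)%N.
  rewrite [X in (_ = _ + X)%N](reindex_inj rev_ord_inj) /= -!big_split /=.
  by apply: eq_bigr => y _; have := ltn_ord y; lia.
have := sum_minn x (t - x); rewrite subnKC// => S.
move: H; rewrite sum_nat_const card_ord; nia.
Qed.

(** The sum is (t^3 - t)/6; the term [t] stands on the left to avoid truncated subtraction. *)
Lemma sum_mul_complement (t : nat) :
  (6 * \sum_(x < t.+1) x * (t - x) + t = t ^ 3)%N.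
Proof.
have S n : (2 * \sum_(x < n.+1) x = n * (n + 1))%N.
  elim: n => [|n IH]; first by rewrite big_ord1.
  by rewrite big_ord_recr /= mulnDr IH; lia.
elim: t => [|t IH]; first by rewrite big_ord1.
rewrite big_ord_recr /= subnn muln0 addn0.
(* Passing from [t] to [t.+1] raises the term at [x] by [x], hence the sum by a triangular
   number. *)
rewrite (eq_bigr (fun x : 'I_t.+1 => x * (t - x) + x)%N); last first.
  by move=> x _; have := ltn_ord x; nia.
rewrite big_split /=; move: IH (S t); rewrite !expnS !expn0.
by move: (\sum_(x < t.+1) x * (t - x))%N (\sum_(x < t.+1) x)%N => A B; lia.
Qed.

(** * The Reeve tetrahedron *)

Definition vec3 (x y z : R) : 'rV[R]_3 := \row_j [:: x; y; z]`_j.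

Lemma vec3E (v : 'rV[R]_3) : v = vec3 (v 0 0) (v 0 1) (v 0 2).
Proof.
by apply/rowP => j; rewrite mxE; case: j => -[|[|[|//]]] ? /=; congr (v _ _);
  exact: val_inj.
Qed.

Definition reeve_vertex (i : 'I_4) : 'rV[R]_3 :=
  [:: vec3 0 0 0; vec3 1 0 0; vec3 0 1 0; vec3 1 1 24]`_i.

(** Barycentric coordinates: only the last vertex has a nonzero third coordinate, 24, so its weight
    is [v 0 2 / 24]; the first two coordinates and the total 1 determine the rest. *)
Definition reeve_weight (v : 'rV[R]_3) (i : 'I_4) : R :=
  [:: 1 - v 0 0 - v 0 1 + v 0 2 / 24; v 0 0 - v 0 2 / 24;
      v 0 1 - v 0 2 / 24; v 0 2 / 24]`_i.

Lemma sum_reeve_weight v : \sum_i reeve_weight v i = 1.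
Proof. by rewrite !big_ord_recl big_ord0 /reeve_weight /=; ring. Qed.

Lemma reeve_barycentric v : \sum_i reeve_weight v i *: reeve_vertex i = v.
Proof.
rewrite [RHS]vec3E; apply/rowP => j.
rewrite !big_ord_recl big_ord0 /reeve_weight /reeve_vertex /= !mxE.
by case: j => -[|[|[|//]]] ? /=; field.
Qed.

(** Up to positive factors, the inequalities say that the four barycentric weights are
    nonnegative. *)
Lemma convex_hull_reeve v :
  convex_hull (range reeve_vertex) v <->
  [/\ 0 <= v 0 2, v 0 2 <= 24 * v 0 0, v 0 2 <= 24 * v 0 1
    & 24 * (v 0 0 + v 0 1 - 1) <= v 0 2].
Proof.
split=> [Cv|[z0 zx zy zxy]].
  have ge f c : scalar f -> (forall i, c <= f (reeve_vertex i)) -> c <= f v.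
    by move=> linf fc; apply: (convex_hull_ge linf _ Cv) => _ [i _ <-].
  split.
  - by apply: (ge (fun v => v 0 2)) => [a x y|[[|[|[|[|//]]]] ?]]; rewrite !mxE.
  - rewrite -subr_ge0; apply: (ge (fun v => 24 * v 0 0 - v 0 2)) => [a x y|].
      by rewrite !mxE; ring.
    by case=> -[|[|[|[|//]]]] ?; rewrite !mxE /=; lra.
  - rewrite -subr_ge0; apply: (ge (fun v => 24 * v 0 1 - v 0 2)) => [a x y|].
      by rewrite !mxE; ring.
    by case=> -[|[|[|[|//]]]] ?; rewrite !mxE /=; lra.
  (* [convex_hull_ge] takes linear functionals, so the constant term of this facet inequality is
     moved to the bound. *)
  - suff : -24 <= v 0 2 - 24 * (v 0 0 + v 0 1) by lra.
    apply: (ge (fun v => v 0 2 - 24 * (v 0 0 + v 0 1))) => [a x y|].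
      by rewrite !mxE; ring.
    by case=> -[|[|[|[|//]]]] ?; rewrite !mxE /=; lra.
rewrite -[v]reeve_barycentric; apply: convex_hull_fin.
- by move=> i; exists i.
- by case=> -[|[|[|[|//]]]] ?; rewrite /reeve_weight /=; lra.
- exact: sum_reeve_weight.
Qed.

Lemma dilate_reeve t v : (0 < t)%N ->
  dilate t (convex_hull (range reeve_vertex)) v <->
  [/\ 0 <= v 0 2, v 0 2 <= 24 * v 0 0, v 0 2 <= 24 * v 0 1
    & 24 * (v 0 0 + v 0 1 - t%:R) <= v 0 2].
Proof.
move=> t0; have t_gt0 : 0 < t%:R :> R by rewrite ltr0n.
split=> [[u /convex_hull_reeve[u1 u2 u3 u4] <-]|[v1 v2 v3 v4]].
  by rewrite !mxE; split; nra.
exists (t%:R^-1 *: v); last by rewrite scalerA divff ?scale1r// gt_eqF.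
have i0 : 0 < t%:R^-1 :> R by rewrite invr_gt0.
have it : t%:R^-1 * t%:R = 1 :> R by rewrite mulVf// gt_eqF.
by apply/convex_hull_reeve; rewrite !mxE; split; nra.
Qed.

(* The lattice points of the t-th dilate lie over the square [0,t]^2, and the
   fibre over (x, y) is the interval from 24 max(0, x + y - t) (a truncated
   subtraction) to 24 min(x, y). *)
Definition reeve_points t : seq (nat * nat * nat) :=
  [seq (xy, z) | xy <- [seq (x, y) | x <- iota 0 t.+1, y <- iota 0 t.+1],
     z <- iota (24 * (xy.1 + xy.2 - t))
               (24 * (minn xy.1 xy.2 - (xy.1 + xy.2 - t))).+1].

Lemma mem_reeve_points t x y z : ((x, y, z) \in reeve_points t) =
  [&& z <= 24 * x, z <= 24 * y & 24 * (x + y) <= z + 24 * t]%N.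
Proof.
apply/allpairsPdep/idP => [[xy [z' [/allpairsP[[x' y'] [+ + ->]] + []]]]|].
  by rewrite !mem_iota /= => ? ? ? -> -> ->; lia.
(* The bounds of the square follow: [z <= 24 * y] and the last inequality give [x <= t], and
   symmetrically for [y]. *)
move=> H; exists (x, y), z; split=> //; last by rewrite mem_iota /=; lia.
by apply/allpairsP; exists (x, y); rewrite !mem_iota; split=> //=; lia.
Qed.

Lemma uniq_reeve_points t : uniq (reeve_points t).
Proof.
apply: allpairs_uniq_dep.
- by apply: allpairs_uniq; rewrite ?iota_uniq// => -[? ?] [? ?].
- by move=> *; exact: iota_uniq.
- by move=> [a b] [a' b'] _ _ /= [-> ->].
Qed.

(** The fibres over a fixed [x] contain [24 * (x * (t - x)) + t.+1] points together; summing over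
    [x] gives 4 (t^3 - t) + (t + 1)^2. *)
Lemma size_reeve_points t :
  (size (reeve_points t) + 4 * t = t.+1 ^ 2 + 4 * t ^ 3)%N.
Proof.
rewrite size_allpairs_dep sumnE big_map big_allpairs.
rewrite -[iota 0 t.+1]/(index_iota 0 t.+1) big_mkord.
rewrite (eq_bigr (fun x : 'I_t.+1 => 24 * (x * (t - x)) + t.+1)%N); last first.
  move=> x _; rewrite big_mkord -sum_reeve_column; last by rewrite -ltnS.
  rewrite big_distrr /= -[X in (_ + X)%N]card_ord -sum1_card -big_split /=.
  by apply: eq_bigr => y _; rewrite size_iota addn1.
rewrite big_split /= sum_nat_const card_ord -big_distrr /=.
have := sum_mul_complement t; rewrite !expnS !expn0.
by move: (\sum_(x < t.+1) x * (t - x))%N => A; lia.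
Qed.

Lemma full_dim_ehrhart_reeve :
  full_dim_ehrhart 3 ((1 + 'X) ^+ 2 + 4 *: ('X^3 - 'X)).
Proof.
exists (range reeve_vertex); split.
- exact: finite_image.
- move=> _ [[[|[|[|[|//]]]] ?] _ <-] [[|[|[|//]]] ?]; rewrite mxE /=;
    by rewrite ?rpred0 ?rpred1 ?natr_int.
- apply/seteqP; split=> // v _; rewrite -[v]reeve_barycentric.
  by apply: affine_hull_fin (sum_reeve_weight v) => i; exists i.
move=> t t0; exists (size (reeve_points t)); split; last first.
  rewrite !hornerE; have /(congr1 (fun n => n%:R : R)) := size_reeve_points t.
  by rewrite !natrD !natrX -natr1; lra.
apply/card_eq_seqP.
pose g (q : nat * nat * nat) := vec3 q.1.1%:R q.1.2%:R q.2%:R.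
exists [seq g q | q <- reeve_points t]; split.
- rewrite map_inj_uniq ?uniq_reeve_points// => -[[x y] z] [[x' y'] z'] /rowP E.
  have := E 0; have := E 1; have := E 2; rewrite !mxE /= => /eqP + /eqP + /eqP.
  by rewrite !eqr_nat => /eqP -> /eqP -> /eqP ->.
- by rewrite size_map.
apply/seteqP; split=> [v [/(dilate_reeve _ t0)[v1 v2 v3 v4] vZ]|v /mapP[[[x y] z]]].
  have [x xE] : exists x : nat, v 0 0 = x%:R.
    by apply/natrP; rewrite -intrEge0 ?vZ//; lra.
  have [y yE] : exists x : nat, v 0 1 = x%:R.
    by apply/natrP; rewrite -intrEge0 ?vZ//; lra.
  have [z zE] : exists x : nat, v 0 2 = x%:R.
    by apply/natrP; rewrite -intrEge0 ?vZ//; lra.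
  apply/mapP; exists (x, y, z); last by rewrite [LHS]vec3E xE yE zE.
  rewrite mem_reeve_points -!(ler_nat R) !(natrM, natrD) -xE -yE -zE.
  by apply/and3P; split; lra.
rewrite mem_reeve_points -!(ler_nat R) !(natrM, natrD) => /and3P[H1 H2 H3] ->.
split; last by move=> [[|[|[|//]]] ?]; rewrite mxE natr_int.
by apply/(dilate_reeve _ t0); rewrite !mxE /=; split => //; lra.
Qed.

(** * Products with a cube and their coefficients *)

Lemma full_dim_ehrhart_cube N p k : full_dim_ehrhart N p ->
  full_dim_ehrhart (N + k) (p * (1 + 'X) ^+ k).
Proof.
move=> Np; elim: k => [|k IH]; first by rewrite addn0 expr0 mulr1.
rewrite exprSr mulrA -addn1 addnA.
exact: full_dim_ehrhartM IH full_dim_ehrhart_segment.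
Qed.

Lemma coef_1DX_exp k j : ((1 + 'X : {poly R}) ^+ k)`_j = 'C(k, j)%:R.
Proof.
elim: k j => [|k IH] [|j]; rewrite ?expr0 ?coef1 ?bin0//.
  by rewrite exprS mulrDl mul1r coefD coefXM IH bin0 addr0.
by rewrite exprS mulrDl mul1r coefD coefXM !IH binS natrD.
Qed.

(** This is [q] times 1 - nX - n^2 X^2 + 5 n^3 X^3 + 4 n^4 X^4, expanded so that each coefficient is
    a sum of shifted coefficients of [q]. *)
Definition reeve_prism_poly (n : R) (q : {poly R}) : {poly R} :=
  q - n *: ('X * q) - n ^+ 2 *: ('X^2 * q) + (5 * n ^+ 3) *: ('X^3 * q)
    + (4 * n ^+ 4) *: ('X^4 * q).

Lemma coef_reeve_prism n q j : (reeve_prism_poly n q)`_j =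
  q`_j - n * (if j == 0%N then 0 else q`_j.-1)
  - n ^+ 2 * (if (j < 2)%N then 0 else q`_(j - 2))
  + 5 * n ^+ 3 * (if (j < 3)%N then 0 else q`_(j - 3))
  + 4 * n ^+ 4 * (if (j < 4)%N then 0 else q`_(j - 4)).
Proof.
by rewrite /reeve_prism_poly 2!coefD 2!coefB !coefZ coefXM !coefXnM.
Qed.

Lemma full_dim_ehrhart_reeve_prism n k : (0 < n)%N ->
  full_dim_ehrhart (4 + k) (reeve_prism_poly n%:R ((1 + 'X) ^+ k)).
Proof.
move=> n0; apply: full_dim_ehrhart_eq; last first.
  apply: full_dim_ehrhart_cube; apply: (full_dim_ehrhart_dilate n0).
  exact: full_dim_ehrhartM full_dim_ehrhart_reeve full_dim_ehrhart_segment.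
by move=> t; rewrite !(horner_comp, hornerE) /=; ring.
Qed.
End ReevePrism.

(** * Choice of the dilation factor and signs of the coefficients *)

Lemma bin_leq_exp2 k j : ('C(k, j) <= 2 ^ k)%N.
Proof.
elim: k j => [|k IH] [|j]; rewrite ?bin0 ?expn_gt0//.
by rewrite binS expnS mul2n -addnn leq_add.
Qed.

Theorem theorem4p3 (R : realType) (d : nat) (hd : (4 <= d)%N) :
  exists (N : nat) (P : set 'rV[R]_N) (p : {poly R}),
    [/\ integral_polytope P, has_dim P d, is_ehrhart_polynomial P p,
        p`_1 < 0 /\ p`_2 < 0
      & forall k : nat, (3 <= k <= d - 2)%N -> 0 < p`_k].
Proof.
pose k := (d - 4)%N; have dE : d = (4 + k)%N by rewrite subnKC.
(* The dilation factor exceeds all binomial coefficients of the cube factor at once. *)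
have [n Bn] : exists n : nat, forall j, ('C(k, j) < n)%N.
  by exists (2 ^ k).+1 => j; rewrite ltnS bin_leq_exp2.
have n0 : (0 < n)%N := leq_ltn_trans (leq0n _) (Bn 0).
have [P [P_int P_dim P_ehr]] :=
  full_dim_ehrhart_polytope (full_dim_ehrhart_reeve_prism R k n0).
exists (4 + k)%N, P, (reeve_prism_poly n%:R ((1 + 'X) ^+ k)).
have n1 : 1 <= n%:R :> R by rewrite ler1n.
have B j : 0 <= ('C(k, j)%:R : R) < n%:R by rewrite ler0n ltr_nat Bn.
split=> //; first by rewrite dE.
  (* The coefficients are k - n and C(k,2) - nk - n^2, where k and C(k,2) are below n and n <=
     n^2. *)
  rewrite !coef_reeve_prism !coef_1DX_exp /= bin0.
  have := B 1; have := B 2; rewrite bin1 => /andP[? ?] /andP[? ?].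
  split; nra.
move=> [|[|[|m]]]//= mk; rewrite dE in mk.
(* Since [d - 2] is [k + 2], the degree bound on [m.+3] forces [m < k]. *)
have Bm : 1 <= 'C(k, m)%:R :> R by rewrite ler1n bin_gt0; lia.
rewrite !coef_reeve_prism !coef_1DX_exp /=.
rewrite !subSS !subn0.
have n_gt0 : 0 < n%:R :> R by rewrite ltr0n.
(* The two negative terms are at most n^3 and n^2 <= n^3 in size, while the term with factor 5 is at
   least 5 n^3. *)
have B1 : n%:R ^+ 2 * 'C(k, m.+1)%:R <= n%:R ^+ 3 :> R.
  by rewrite [leRHS]exprSr ler_wpM2l ?exprn_ge0 ?ltW//; case/andP: (B m.+1).
have B2 : n%:R * 'C(k, m.+2)%:R <= n%:R ^+ 2 :> R.
  by rewrite expr2 ler_wpM2l ?ltW//; case/andP: (B m.+2).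
have B0 : 5 * n%:R ^+ 3 <= 5 * n%:R ^+ 3 * 'C(k, m)%:R :> R.
  by rewrite ler_peMr// mulr_ge0// exprn_ge0.
(* For [m = 0] the guard returns 0, so the truncated index [m - 1] is never read there. *)
have B4 : 0 <= 4 * n%:R ^+ 4 * (if (m.+3 < 4)%N then 0 else 'C(k, m - 1)%:R) :> R.
  by rewrite mulr_ge0 ?mulr_ge0 ?exprn_ge0//; case: ifP.
have n23 : n%:R ^+ 2 <= n%:R ^+ 3 :> R by rewrite ler_weXn2l.
have n3 : 0 < n%:R ^+ 3 :> R by rewrite exprn_gt0.
have /andP[B3 _] := B m.+3.
by move: B4; set c4 := (_ * (if _ then _ else _)) => B4; lra.
Qed.
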